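(* Let $P$ be a finite poset and $\mathcal{C}(P)$ the set of chains of $P$. If $P$ is the ordinal sum of two posets $P=P_1\oplus P_2$, then $T(\mathcal{C}(P))\cong T(\mathcal{C}(P_1))\times T(\mathcal{C}(P_2))$. If $P$ is not the ordinal sum of two nonempty posets, then $\mathcal{C}(P)$ is toggle-alternating.
   Context: A chain in a poset $P$ is a set of mutually comparable elements (the empty set is a chain). $\mathcal{C}(P)\subseteq 2^P$ is the set of chains, with ground set $P$. The ordinal sum $P_1\oplus P_2$ of posets is the poset on the (disjoint) union of $P_1$ and $P_2$ with $e\le f$ if and only if $e,f\in P_1$ and $e\le_{P_1}f$, or $e,f\in P_2$ and $e\le_{P_2}f$, or $e\in P_1$ and $f\in P_2$. For a finite set $E$ and $\mathcal{L}\subseteq 2^E$, the toggle of $e\in E$ is the map $t_e:\mathcal{L}\to\mathcal{L}$ with $t_e(X)=X\cup\{e\}$ if $e\notin X$ and $X\cup\{e\}\in\mathcal{L}$; $t_e(X)=X\setminus\{e\}$ if $e\in X$ and $X\setminus\{e\}\in\mathcal{L}$; and $t_e(X)=X$ otherwise. The toggle group $T(\mathcal{L})$ is the subgroup of the symmetric group $\mathfrak{S}_{\mathcal{L}}$ generated by $\{t_e\mid e\in E\}$. $\mathcal{L}$ is toggle-alternating if $T(\mathcal{L})$ contains the alternating group $A_{\mathcal{L}}$. *)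

(* Defs.v *)
From HB Require Import structures.
From mathcomp Require Import all_boot all_order all_fingroup all_solvable.

Set Implicit Arguments.
Unset Strict Implicit.
Unset Printing Implicit Defensive.

Import GroupScope.

Section Toggle.

Variables (E : finType) (L : {set {set E}}).

Definition toggle_set (e : E) (X : {set E}) : {set E} :=
  if (e \notin X) && (e |: X \in L) then e |: X
  else if (e \in X) && (X :\ e \in L) then X :\ e
  else X.

Fact toggle_set_in (e : E) (X : {X : {set E} | X \in L}) :
  toggle_set e (val X) \in L.
Proof.
rewrite /toggle_set; case: ifP => [/andP[]//|_].
by case: ifP => [/andP[]//|_]; apply: valP.
Qed.

Definition toggle_fun (e : E) (X : {X : {set E} | X \in L}) :
  {X : {set E} | X \in L} := Sub (toggle_set e (val X)) (toggle_set_in e X).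

Fact toggle_funK (e : E) : involutive (toggle_fun e).
Proof.
move=> X; apply: val_inj => /=; move: (valP X); set Y := val X => YL.
rewrite [toggle_set e Y]/toggle_set; case: ifP => [/andP[eY _]|nadd].
  by rewrite /toggle_set setU11 /= setU1K // YL.
case: ifP => [/andP[eY _]|nrem]; last by rewrite /toggle_set nadd nrem.
by rewrite /toggle_set setD11 /= setD1K // YL.
Qed.

Definition toggle (e : E) : {perm {X : {set E} | X \in L}} :=
  perm (can_inj (toggle_funK e)).

Definition toggle_group : {group {perm {X : {set E} | X \in L}}} :=
  <<[set toggle e | e : E]>>%G.

Definition toggle_alternating : bool :=
  'Alt_({X : {set E} | X \in L}) \subset toggle_group.

End Toggle.

Definition chains (d : Order.disp_t) (P : finPOrderType d) : {set {set P}} :=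
  [set X : {set P} | [forall x in X, forall y in X, (x >=< y)%O]].

Definition osum (T1 T2 : Type) : Type := (T1 + T2)%type.

Fact osum_display (d1 d2 : Order.disp_t) : Order.disp_t.
Proof. exact: (Order.Disp tt tt). Qed.

Section OrdinalSum.

Variables (d1 d2 : Order.disp_t).
Variables (P1 : finPOrderType d1) (P2 : finPOrderType d2).

HB.instance Definition _ := Finite.on (osum P1 P2).

Definition osum_le (u v : osum P1 P2) : bool :=
  match u, v with
  | inl e, inl f => (e <= f)%O
  | inr e, inr f => (e <= f)%O
  | inl _, inr _ => true
  | inr _, inl _ => false
  end.

Fact osum_le_refl : reflexive osum_le.
Proof. by case=> x /=; apply: Order.POrderTheory.lexx. Qed.

Fact osum_le_anti : antisymmetric osum_le.
Proof.
by case=> [x|x] [y|y] //= /Order.POrderTheory.le_anti->.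
Qed.

Fact osum_le_trans : transitive osum_le.
Proof.
by case=> [y|y] [x|x] [z|z] //=; apply: Order.POrderTheory.le_trans.
Qed.

HB.instance Definition _ :=
  Order.Le_isPOrder.Build (osum_display d1 d2) (osum P1 P2)
    osum_le_refl osum_le_anti osum_le_trans.

End OrdinalSum.

Definition poset_iso (d d' : Order.disp_t)
    (P : porderType d) (Q : porderType d') : Prop :=
  exists2 f : P -> Q, bijective f & {mono f : x y / (x <= y)%O}.

(* "P is the ordinal sum of P1 and P2" is read up to order isomorphism, which
   covers in particular the case where P1 and P2 are subposets of P. *)
Definition is_ordinal_sum (d d1 d2 : Order.disp_t) (P : finPOrderType d)
    (P1 : finPOrderType d1) (P2 : finPOrderType d2) : Prop :=
  poset_iso P (osum P1 P2).

Definition ordinally_decomposable (d : Order.disp_t) (P : finPOrderType d)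
    : Prop :=
  exists (d1 d2 : Order.disp_t)
         (P1 : finPOrderType d1) (P2 : finPOrderType d2),
    [/\ 0 < #|P1|, 0 < #|P2| & is_ordinal_sum P P1 P2].

(* Main.v *)
(* Chains are the independent sets of the incomparability graph, and a poset is
   ordinally indecomposable exactly when this graph is connected.

   For a connected graph, call a permutation of the independent sets U-local if
   it fixes every X with an element outside U adjacent to U, and otherwise only
   changes the part X :&: U, in a way that depends on X :&: U alone. The toggle
   at u is [set u]-local, and if g is U-local and w is adjacent to U, then the
   commutator of g with the toggle at w is (w |: U)-local. Growing U one vertex
   at a time, such commutators yield a U-local element of the toggle group that
   acts on the independent sets inside U as a 3-cycle moving set0 and [set w];
   conjugating by toggles links set0 to every other independent set by a
   3-cycle, hence all 3-cycles occur. For U = setT this gives the alternating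
   group.

   For an ordinal sum, a chain is a pair of chains, and each toggle acts on one
   of the two components. *)

From HB Require Import structures.
Require Import Defs.
From mathcomp Require Import all_boot all_order all_fingroup all_solvable.

Set Implicit Arguments.
Unset Strict Implicit.
Unset Printing Implicit Defensive.

(** * 3-cycles *)

Section ThreeCycles.

Local Open Scope group_scope.

Variable T : finType.
Implicit Types (a b c x y z : T) (D : {group {perm T}}).

(** Products apply the left factor first, so on distinct points this cycle sends [a] to [b], [b] to
    [c] and [c] to [a]. *)
Definition cyc3 a b c : {perm T} := tperm a b * tperm a c.

Local Ltac dist := solve [assumption | rewrite eq_sym; assumption].

Lemma cyc3_rot a b c : a != c -> b != c -> cyc3 a b c = cyc3 b c a.
Proof.
move=> ac bc; rewrite /cyc3 [tperm b a]tpermC -(tpermJ_tperm ac bc).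
by rewrite conjgE tpermV -!mulgA tperm2 mulg1.
Qed.

Lemma cyc3V a b c : (cyc3 a b c)^-1 = cyc3 a c b.
Proof. by rewrite invMg !tpermV. Qed.

Lemma cyc3J a b c (s : {perm T}) : cyc3 a b c ^ s = cyc3 (s a) (s b) (s c).
Proof. by rewrite conjMg !tpermJ. Qed.

Lemma cyc31 a b c : a != b -> b != c -> cyc3 a b c a = b.
Proof. by move=> ab bc; rewrite permM tpermL tpermD // eq_sym. Qed.

Lemma cyc33 a b c : a != c -> b != c -> cyc3 a b c c = a.
Proof. by move=> ac bc; rewrite permM [tperm a b c]tpermD // tpermR. Qed.

Lemma cyc3D a b c x : a != x -> b != x -> c != x -> cyc3 a b c x = x.
Proof. by move=> ax bx cx; rewrite permM !tpermD. Qed.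

Lemma cyc3_quotient a a' b c : a != c -> b != c -> a' != c -> a != b ->
  a' != b -> a != a' -> (cyc3 a b c)^-1 * cyc3 a' b c = cyc3 a a' b.
Proof.
move=> ac bc a'c ab a'b aa'.
rewrite cyc3V -(@cyc3_rot b) ?[cyc3 a' b c]cyc3_rot; try dist.
rewrite -(@cyc3_rot b); try dist.
by rewrite /cyc3 mulgA -(mulgA (tperm b a)) tperm2 mulg1.
Qed.

(** Conjugation by its own inverse does not change [cyc3 a b c], so only conjugation by
    [cyc3 a' b' c] acts: it replaces [c] by [a'], and then a transposition cancels. *)
Lemma cyc3_commutator a b c a' b' : uniq [:: a; b; c; a'; b'] ->
  [~ cyc3 a b c, (cyc3 a b c)^-1 * cyc3 a' b' c] = cyc3 a c a'.
Proof.
rewrite /= !inE !negb_or => /and5P[/and4P[ab ac aa' ab'] /and3P[bc ba' bb']].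
case/andP=> ca' cb' a'b' _.
rewrite commgEl conjgM [_ ^ _^-1]conjgE invgK mulgV mulg1.
rewrite cyc3J (@cyc3D _ _ _ a) ?(@cyc3D _ _ _ b); try dist.
rewrite cyc33 ?cyc3V; try dist.
by rewrite /cyc3 mulgA -(mulgA (tperm a c)) tperm2 mulg1.
Qed.

Lemma cyc3_glue D x y z t s :
    x != y -> y != z -> x != z -> t != x -> t != y -> s != y -> s != z ->
  cyc3 x y t \in D -> cyc3 y z s \in D -> cyc3 x y z \in D.
Proof.
move=> xy yz xz tx ty sy sz Dxyt Dyzs.
have [<-//|tz] := eqVneq t z.
have [sx|sx] := eqVneq s x.
  by rewrite sx -cyc3_rot in Dyzs; dist.
have xs : x != s by dist.
(* Conjugating [cyc3 x y t] by [cyc3 y z s] fixes [x] and moves [y] to [z]. If [t] is [s], the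
   result is the inverse of [cyc3 x y z]; otherwise it is [cyc3 x z t], and a further conjugation by
   [cyc3 x y t] gives a rotation of [cyc3 x y z]. *)
have := groupJ Dxyt Dyzs.
rewrite cyc3J (@cyc3D y z s x) ?cyc31; try dist.
have [->|ts] := eqVneq t s.
  by rewrite cyc33 -?[cyc3 x y z]cyc3V ?groupV; try dist.
rewrite cyc3D => [Dxzt||| ]; try dist.
have := groupJ Dxzt Dxyt; rewrite cyc3J cyc31 ?cyc33 ?(cyc3D xz yz tz); try dist.
by rewrite -cyc3_rot; try dist.
Qed.

(* Any two overlapping 3-cycles of D can be recombined (cyc3_glue), so the pairs
   occurring in 3-cycles of D form an equivalence relation. *)
Definition link D x y : Prop :=
  x = y \/ exists z, [/\ z != x, z != y & cyc3 x y z \in D].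

Lemma link_sym D x y : link D x y -> link D y x.
Proof.
have [->//|xy [/eqP|[z [zx zy Dxyz]]]] := eqVneq x y; first by rewrite (negPf xy).
by right; exists z; rewrite zx zy -groupV cyc3V -cyc3_rot //; dist.
Qed.

Lemma cyc3_link D x y z : x != y -> y != z -> x != z ->
  link D x y -> link D y z -> cyc3 x y z \in D.
Proof.
move=> xy yz xz [/eqP|[t [tx ty Dt]]]; first by rewrite (negPf xy).
case=> [/eqP|[s [sy sz Ds]]]; first by rewrite (negPf yz).
exact: cyc3_glue Dt Ds.
Qed.

Lemma link_trans D y x z : link D x y -> link D y z -> link D x z.
Proof.
have [->//|xy] := eqVneq x y; have [<-//|yz] := eqVneq y z.
have [->|xz] := eqVneq x z; first by left.
move=> Dxy Dyz; apply: link_sym; right; exists y; split; [dist | dist |].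
by rewrite cyc3_rot ?cyc3_link; try dist.
Qed.

Lemma linkJ D x y (s : {perm T}) : s \in 'N(D) ->
  link D x y -> link D (s x) (s y).
Proof.
move=> Ns [->|[z [zx zy Dz]]]; [by left | right].
by exists (s z); rewrite !(inj_eq (@perm_inj _ s)) zx zy -cyc3J memJ_norm.
Qed.

Lemma Alt_sub_cyc3 D z :
    (forall x y, x != z -> y != z -> x != y -> cyc3 z x y \in D) ->
  'Alt_T \subset D.
Proof.
move=> Dz; have [x0 /= x0z|Tz] := pickP [pred x | x != z]; last first.
  rewrite trivial_Alt_2 ?sub1G //; apply: leq_trans (leqnSn 1).
  apply/card_le1P=> x _ y.
  by rewrite !inE (eqP (negbFE (Tz x))) (eqP (negbFE (Tz y))) eqxx.
have Dt x y : x != z -> y != z -> tperm z x * tperm z y \in D.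
  move=> xz yz; have [->|xy] := eqVneq x y; first by rewrite tperm2.
  exact: Dz.
(* The claim covers odd permutations too, so that induction along a word in the transpositions
   [tperm z y] works: odd prefixes are completed by the fixed transposition [tperm z x0]. *)
suff E s : (if odd_perm s then s * tperm z x0 else s) \in D.
  by apply/subsetP=> s; rewrite Alt_even => /negPf es; have := E s; rewrite es.
have : s \in <<[set tperm z y | y in T]>> by rewrite gen_tperm inE.
case/gen_prodgP=> n [c /= cT ->{s}].
elim: n c cT => [|n IHn] c cT; first by rewrite big_ord0 odd_perm1.
rewrite big_ord_recr /=; set s := \prod_(i < n) _.
have {IHn} : (if odd_perm s then s * tperm z x0 else s) \in D by apply: IHn.
have /imsetP[x _ ->] := cT ord_max.
have [->|xz] := eqVneq x z; first by rewrite tperm1 mulg1.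
rewrite odd_permM odd_tperm [z == x]eq_sym xz addbT /=; case: odd_perm => /= Ds.
  have := groupM Ds (Dt _ _ x0z xz).
  by rewrite mulgA -(mulgA s) tperm2 mulg1.
by rewrite -mulgA groupM ?Dt.
Qed.

End ThreeCycles.

(** * Groups induced on a subset *)

Section Trace.

Local Open Scope group_scope.

Variable T : finType.
Implicit Types (A : {set T}) (G : {group {perm T}}) (g h s t : {perm T}).

Definition agree A g s := [forall x in A, (g x == s x) && (g x \in A)].

Lemma agreeP A g s :
  reflect {in A, forall x, g x = s x /\ g x \in A} (agree A g s).
Proof.
apply: (iffP forall_inP) => gs x Ax; first by have /andP[/eqP] := gs x Ax.
by have [-> ->] := gs x Ax; rewrite eqxx.
Qed.

Lemma agreeM A g h s t : agree A g s -> agree A h t -> agree A (g * h) (s * t).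
Proof.
move=> /agreeP gs /agreeP ht; apply/agreeP=> x Ax; rewrite !permM.
by have [<- Agx] := gs x Ax; apply: ht.
Qed.

Lemma agreeV A g s : agree A g s -> agree A g^-1 s^-1.
Proof.
move=> /agreeP gs; have /eqP gA : g @: A == A.
  rewrite eqEcard card_imset ?leqnn ?andbT; last exact: perm_inj.
  by apply/subsetP=> _ /imsetP[x Ax ->]; have [] := gs x Ax.
apply/agreeP=> x; rewrite -{1}gA => /imsetP[y Ay ->].
by rewrite permK {1}(gs y Ay).1 permK.
Qed.

Lemma agreeJ A g h s t : agree A g s -> agree A h t -> agree A (g ^ h) (s ^ t).
Proof. by move=> gs ht; rewrite !conjgE !agreeM ?agreeV. Qed.

(** The restriction to [A] of the stabiliser of [A] in [G], encoded by all its extensions to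
    permutations of [T], which avoids permutations of a subtype. *)
Definition trace A G := [set s | [exists g in G, agree A g s]].

Lemma traceP A G s :
  reflect (exists2 g, g \in G & agree A g s) (s \in trace A G).
Proof. by rewrite inE; apply: exists_inP. Qed.

Fact trace_group_set A G : group_set (trace A G).
Proof.
apply/group_setP; split=> [|s t /traceP[g Gg gs] /traceP[h Gh ht]].
  by apply/traceP; exists 1; rewrite ?group1 //; apply/agreeP=> x; rewrite perm1.
by apply/traceP; exists (g * h); rewrite ?groupM ?agreeM.
Qed.
Canonical trace_group A G := Group (trace_group_set A G).

Lemma trace_norm A (M N : {group {perm T}}) :
  N \subset 'N(M) -> trace A N \subset 'N(trace A M).
Proof.
move=> /subsetP nMN; apply/subsetP=> t /traceP[h Nh ht].
rewrite inE; apply/subsetP=> _ /imsetP[s /traceP[g Mg gs] ->].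
by apply/traceP; exists (g ^ h); rewrite ?agreeJ // memJ_norm ?nMN.
Qed.

Lemma trace_setT G : trace setT G \subset G.
Proof.
apply/subsetP=> s /traceP[g Gg /agreeP gs].
suff <- : g = s by [].
by apply/permP=> x; have [] := gs x (in_setT x).
Qed.

End Trace.

(** * Independent sets of a graph *)

Section IndependentSets.

Local Open Scope group_scope.

Variables (V : finType) (adj : rel V).
Hypotheses (adj_sym : symmetric adj) (adj_irr : irreflexive adj).

Definition independent : {set {set V}} :=
  [set X : {set V} | [forall x in X, forall y in X, ~~ adj x y]].

Local Notation L := independent.
Local Notation S := {X : {set V} | X \in L}.
Local Notation T := (toggle_group L).
Implicit Types (u v w x y : V) (U : {set V}) (X Y : S) (g h s : {perm S}).

Lemma independentP (X : {set V}) :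
  reflect {in X &, forall x y, adj x y = false} (X \in L).
Proof.
rewrite inE; apply: (iffP forall_inP) => indX x => [y Xx Xy | Xx].
  by apply/negbTE; have /forall_inP := indX x Xx; apply.
by apply/forall_inP=> y Xy; rewrite indX.
Qed.

Lemma sub_independent (X Y : {set V}) : X \subset Y -> Y \in L -> X \in L.
Proof.
move=> /subsetP XY /independentP indY; apply/independentP=> x y Xx Xy.
by rewrite indY ?XY.
Qed.

Lemma ind0_subproof : set0 \in L.
Proof. by apply/independentP=> x y; rewrite inE. Qed.

Lemma ind1_subproof v : [set v] \in L.
Proof. by apply/independentP=> x y; rewrite !inE => /eqP-> /eqP->. Qed.

Lemma indI_subproof U X : val X :&: U \in L.
Proof. exact: sub_independent (subsetIl _ _) (valP X). Qed.

Definition ind0 : S := Sub set0 ind0_subproof.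
Definition ind1 v : S := Sub [set v] (ind1_subproof v).
Definition indI U X : S := Sub (val X :&: U) (indI_subproof U X).

(** Subsets of independent sets are independent, so a removal is never refused; an insertion is
    refused exactly when a neighbour of [v] is present. *)
Lemma val_toggle v X : val (toggle L v X) =
  if v \in val X then val X :\ v
  else if [exists x in val X, adj v x] then val X else v |: val X.
Proof.
rewrite permE /= /toggle_set; have [Xv|nXv] /= := boolP (v \in val X).
  by rewrite (sub_independent (subD1set _ _) (valP X)).
have [/exists_inP[x Xx vx]|/exists_inPn nvX] := boolP [exists x in val X, adj v x].
  rewrite ifN //; apply/independentP=> /(_ v x).
  by rewrite !inE eqxx Xx orbT vx => /(_ isT isT).
rewrite ifT //; apply/independentP=> x y; rewrite !inE.
have /independentP indX := valP X.
move=> /predU1P[->|Xx] /predU1P[->|Xy]; first by rewrite adj_irr.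
- exact/negbTE/nvX.
- by rewrite adj_sym; apply/negbTE/nvX.
- exact: indX.
Qed.

Lemma toggleK v : involutive (toggle L v).
Proof. by move=> X; rewrite !permE toggle_funK. Qed.

Lemma toggle_in_group v : toggle L v \in T.
Proof. by rewrite mem_gen ?imset_f. Qed.

Lemma toggle0 v : toggle L v ind0 = ind1 v.
Proof.
apply: val_inj; rewrite val_toggle /= inE ifN ?setU0 //.
by apply/exists_inPn=> x; rewrite inE.
Qed.

Lemma toggle1_adj v w : adj v w -> toggle L v (ind1 w) = ind1 w.
Proof.
move=> vw; apply: val_inj; rewrite val_toggle /= inE.
have [vw1|_] := eqVneq v w; first by rewrite vw1 adj_irr in vw.
by rewrite ifT //; apply/exists_inP; exists w; rewrite ?inE.
Qed.

(** * Permutations acting only inside a vertex set *)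

Definition boundary U := [set y | (y \notin U) && [exists x in U, adj x y]].

Lemma boundaryP U y :
  reflect (y \notin U /\ exists2 x, x \in U & adj x y) (y \in boundary U).
Proof.
rewrite inE; apply: (iffP andP) => -[-> xy]; split=> //; exact/exists_inP.
Qed.

(** Weaker than [U]-locality: a set that meets the boundary may still change inside [U], in any way.
    This leaves room for every toggle at a vertex of [U], while such permutations still normalise
    the [U]-local ones. *)
Definition compatible U := [set g : {perm S} | [forall X : S,
  (val (g X) :\: U == val X :\: U) &&
  ([disjoint val X & boundary U] ==>
     (val (g X) :&: U == val (g (indI U X)) :&: U))]].

Lemma compatibleP U g : reflect
  (forall X, {in ~: U, val (g X) =i val X} /\
     ([disjoint val X & boundary U] ->
        {in U, val (g X) =i val (g (indI U X))}))
  (g \in compatible U).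
Proof.
rewrite inE; apply: (iffP forallP) => gP X.
  have /andP[/eqP/setP gX /implyP gXI] := gP X; split=> [y | /gXI/eqP/setP gI y] Uy.
    by have := gX y; rewrite !inE in Uy *; rewrite Uy.
  by have := gI y; rewrite !inE Uy !andbT.
have [gX gXI] := gP X; apply/andP; split.
  apply/eqP/setP=> y; rewrite !inE.
  by case Uy: (y \in U) => //=; rewrite gX ?inE ?Uy.
apply/implyP=> /gXI gI; apply/eqP/setP=> y; rewrite !inE.
by case Uy: (y \in U); rewrite ?andbF // gI.
Qed.

Fact compatible_group_set U : group_set (compatible U).
Proof.
apply/group_setP; split=> [|g h /compatibleP gP /compatibleP hP].
  by apply/compatibleP=> X; split=> [y _|_ y Uy]; rewrite !perm1 //= inE Uy andbT.
apply/compatibleP=> X; rewrite !permM.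
have [gX gI] := gP X; have [hX hI] := hP (g X); split=> [y Uy | dX y Uy].
  by rewrite hX ?gX.
have dgX : [disjoint val (g X) & boundary U].
  rewrite disjoint_subset; apply/subsetP=> z gXz; rewrite inE.
  apply/negP=> bz; move: (disjointFl dX bz); rewrite -gX ?gXz // inE.
  by case/boundaryP: bz.
rewrite (hI dgX) //; congr (_ \in val (h _)); apply/val_inj/setP=> z /=.
rewrite inE; have [Uz|Uz] := boolP (z \in U); first by rewrite andbT gI.
by rewrite andbF (gP (indI U X)).1 !inE ?(negPf Uz) ?andbF.
Qed.
Canonical compatible_group U := Group (compatible_group_set U).

Lemma compatible_subset U g X :
  g \in compatible U -> (val (g X) \subset U) = (val X \subset U).
Proof.
move=> /compatibleP/(_ X)[gX _].
have outE Y : (val Y \subset U) = [forall y in ~: U, y \notin val Y].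
  apply/subsetP/forall_inP=> YU y; first by rewrite inE; apply/contra/YU.
  by apply: contraLR => Uy; rewrite YU ?inE.
by rewrite !outE; apply: eq_forallb_in => y Uy; rewrite gX.
Qed.

Lemma compatible_disjoint U g X : g \in compatible U ->
  [disjoint val (g X) & boundary U] = [disjoint val X & boundary U].
Proof.
move=> /compatibleP/(_ X)[gX _]; rewrite -!setI_eq0.
congr (_ == _); apply/setP=> y; rewrite !in_setI andbC [RHS]andbC.
by apply: andb_id2l => /boundaryP[Uy _]; rewrite gX ?inE.
Qed.

(** A neighbour of [u] in [X] outside [U] would be a boundary vertex, so away from the boundary it
    is decided inside [U] whether the toggle is blocked. *)
Lemma toggle_compatible U u : u \in U -> toggle L u \in compatible U.
Proof.
move=> Uu; apply/compatibleP=> X; split=> [y | dX y Uy]; rewrite !val_toggle.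
  rewrite inE => Uy; have yu : y != u by apply: contraNneq Uy => ->.
  by case: ifP => _; [|case: ifP => _]; rewrite // !inE ?yu ?(negPf yu).
have -> : [exists x in val (indI U X), adj u x] = [exists x in val X, adj u x].
  apply/exists_inP/exists_inP=> -[x Xx ux]; exists x => //.
    by move: Xx; rewrite inE => /andP[].
  rewrite inE Xx; apply: contraFT (disjointFr dX Xx) => Ux.
  by apply/boundaryP; split=> //; exists u.
rewrite /= in_setI Uu andbT.
by case: ifP => _; [|case: ifP => _]; rewrite !inE ?Uy ?andbT.
Qed.

Definition local U :=
  [set g : {perm S} in compatible U |
    [forall X : S, ~~ [disjoint val X & boundary U] ==> (g X == X)]].

Lemma localP U g : reflect
  (g \in compatible U /\ forall X, ~~ [disjoint val X & boundary U] -> g X = X)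
  (g \in local U).
Proof.
rewrite [g \in local U]inE; apply: (iffP andP) => -[gC gP]; split=> //.
  by move=> X; have /implyP gX := forallP gP X; move/gX/eqP.
by apply/forallP=> X; apply/implyP=> /gP->.
Qed.

Fact local_group_set U : group_set (local U).
Proof.
apply/group_setP; split=> [|g h /localP[gC gP] /localP[hC hP]].
  by apply/localP; split=> [|X _]; rewrite ?group1 ?perm1.
by apply/localP; split=> [|X dX]; rewrite ?groupM // permM gP ?hP.
Qed.
Canonical local_group U := Group (local_group_set U).

Lemma compatible_norm_local U : compatible U \subset 'N(local U).
Proof.
apply/subsetP=> h hC; rewrite inE; apply/subsetP=> _ /imsetP[g /localP[gC gP] ->].
apply/localP; split=> [|X dX]; first by rewrite groupJ.
by rewrite conjgE !permM gP ?permKV // compatible_disjoint ?groupV.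
Qed.

(** Let [X] avoid the boundary of [U']. If it meets the boundary of [U], it does so inside [U'], so
    [X] and its part in [U'] are both fixed; otherwise both have the same part in [U], which
    determines the action. *)
Lemma local_compatible U U' : U \subset U' -> local U \subset compatible U'.
Proof.
move=> /subsetP UU'; apply/subsetP=> g /localP[/compatibleP gC gP].
apply/compatibleP=> X; have [gX gI] := gC X; split=> [y|dX' y U'y].
  rewrite inE => U'y; apply: gX; rewrite inE; exact: contra (UU' y) _.
have [dX|ndX] := boolP [disjoint val X & boundary U]; last first.
  rewrite !gP ?inE ?U'y ?andbT //.
  apply: contra ndX; rewrite !disjoint_subset => /subsetP sX; apply/subsetP=> x Xx.
  have [U'x|U'x] := boolP (x \in U'); first by apply: sX; rewrite inE Xx.
  apply: contraFN (disjointFr dX' Xx) => /boundaryP[_ [z Uz zx]].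
  by apply/boundaryP; split=> //; exists z; rewrite ?UU'.
have [gX' gI'] := gC (indI U' X).
have [Uy|nUy] := boolP (y \in U); last by rewrite gX ?gX' !inE ?U'y ?andbT.
rewrite gI ?gI' //; last first.
  by apply: disjointWl dX; rewrite subsetIl.
congr (_ \in val (g _)); apply/val_inj/setP=> z; rewrite !inE.
by case Uz: (z \in U); rewrite ?andbF // UU' ?andbT.
Qed.

(** A boundary vertex [y] of [w |: U] is adjacent to [w] or to a vertex of [U]. Sets containing [y]
    are then fixed by the toggle at [w] or by [g] respectively, so the two commute on these sets. *)
Lemma local_commutator U g w : g \in local U -> w \in boundary U ->
  [~ g, toggle L w] \in local (w |: U).
Proof.
move=> gL wU; have gC := subsetP (local_compatible (subsetUr [set w] U)) g gL.
have tC : toggle L w \in compatible (w |: U) by rewrite toggle_compatible ?setU11.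
have [/compatibleP gC0 gP] := localP _ _ gL.
apply/localP; split=> [|X]; first by rewrite groupR.
case/pred0Pn=> y /= /andP[Xy yb]; have [yU' [x xU' xy]] := boundaryP _ _ yb.
have commY Y : y \in val Y -> toggle L w (g Y) = g (toggle L w Y).
  move=> Yy; have [yU yw] : y \notin U /\ y != w.
    by move: yU'; rewrite !inE negb_or => /andP[].
  have gYy : y \in val (g Y) by rewrite (gC0 Y).1 // inE.
  have fixt (Z : S) : adj w y -> y \in val Z -> toggle L w Z = Z.
    move=> wy Zy; have wZ : w \notin val Z.
      by apply: contraTN wy => Zw; have /independentP-> := valP Z.
    apply: val_inj; rewrite val_toggle (negPf wZ) ifT //.
    by apply/exists_inP; exists y.
  move: xU'; rewrite !inE => /predU1P[xw | Ux]; first by rewrite !fixt -?xw.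
  have yb0 : y \in boundary U by apply/boundaryP; split=> //; exists x.
  have fixg (Z : S) : y \in val Z -> g Z = Z.
    by move=> Zy; apply: gP; apply/pred0Pn; exists y; rewrite /= Zy.
  rewrite !fixg // (compatibleP _ _ tC Y).1 //; by rewrite inE.
set h := toggle L w in tC commY *.
(* The commutation is applied to the preimage of [X] under [h] followed by [g]; it still contains
   [y] because neither map changes anything outside [w |: U]. *)
rewrite -{2}[X](permKV g) -[g^-1 X](permKV h) -commY -?permM; last first.
  have /compatibleP/(_ X)[-> //] : g^-1 * h^-1 \in compatible (w |: U).
    by rewrite groupM ?groupV.
  by rewrite in_setC.
by rewrite commgEl conjgE !permM.
Qed.

(** * Traces on the independent sets inside a vertex set *)

Definition below U : {set S} := [set X : S | val X \subset U].

Local Notation M U := (local_group U :&: T)%G.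
Local Notation N U := (compatible_group U :&: T)%G.

Local Notation D U := (trace_group (below U) (M U)).

Lemma agree_below U g : g \in compatible U -> agree (below U) g g.
Proof.
by move=> gC; apply/agreeP=> X; rewrite !inE => XU; rewrite compatible_subset.
Qed.

Lemma trace_compatible_norm U g s :
    g \in compatible U -> g \in T -> agree (below U) g s -> s \in 'N(D U).
Proof.
move=> gC gT gs; apply: (subsetP (trace_norm (below U) (M := M U) (N := N U) _)).
  by rewrite normsI // ?subIset ?compatible_norm_local ?normG ?orbT.
by apply/traceP; exists g; rewrite // inE gC.
Qed.

Lemma toggle_norm U u : u \in U -> toggle L u \in 'N(D U).
Proof.
move=> Uu; have tC := toggle_compatible Uu.
exact: trace_compatible_norm tC (toggle_in_group u) (agree_below tC).
Qed.

Lemma agree_extend U w g s :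
    g \in local U -> w \in boundary U -> agree (below U) g s ->
    (forall X, w \in val X -> s X = X) -> agree (below (w |: U)) g s.
Proof.
move=> gL wU /agreeP gs sid; apply/agreeP=> X; rewrite inE => XwU.
have gC := subsetP (local_compatible (subsetUr [set w] U)) g gL.
split; last by rewrite inE compatible_subset.
have [wX|wX] := boolP (w \in val X).
  rewrite sid //; have [_ ->//] := localP _ _ gL.
  by apply/pred0Pn; exists w; rewrite /= wX.
have [|-> //] := gs X; rewrite inE; apply/subsetP=> x Xx.
have := subsetP XwU x Xx; rewrite !inE => /predU1P[xw|//].
by rewrite -xw Xx in wX.
Qed.

(** [g] is compatible with [w |: U] but need not be local there; this is why [s] is only shown to
    normalise the new trace, while the commutator lies in it. *)
Lemma commutator_trace U w g s :
    g \in M U -> w \in boundary U -> agree (below U) g s ->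
    (forall X, w \in val X -> s X = X) ->
  [~ s, toggle L w] \in D (w |: U) /\ s \in 'N(D (w |: U)).
Proof.
rewrite inE => /andP[gL gT] wU gs sid.
have gs' := agree_extend gL wU gs sid.
have gC := subsetP (local_compatible (subsetUr [set w] U)) g gL.
split; last exact: trace_compatible_norm gC gT gs'.
apply/traceP; exists [~ g, toggle L w].
  by rewrite inE local_commutator ?groupR ?toggle_in_group.
rewrite !commgEl agreeM ?agreeV ?agreeJ ?agree_below //.
by rewrite toggle_compatible ?setU11.
Qed.

(** An induction principle along edges inside [U], with [Prop]-valued predicates so that it applies
    to [link]. The empty set counts as connected. *)
Definition connected U := forall Z : V -> Prop, (exists2 x, x \in U & Z x) ->
  {in U &, forall x y, Z x -> adj x y -> Z y} -> {in U, forall x, Z x}.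

Lemma connected1 u : connected [set u].
Proof. by move=> Z [x /set1P-> Zu] _ y /set1P->. Qed.

Lemma connectedU1 U w : connected U -> w \in boundary U -> connected (w |: U).
Proof.
move=> cU /boundaryP[_ [u Uu uw]] Z [z zU Zz] Zadj.
have wU : w \in w |: U by rewrite setU11.
have UwU x : x \in U -> x \in w |: U by apply: setU1r.
have UZ : {in U, forall x, Z x}.
  apply: cU => [|x y Ux Uy]; last by apply: Zadj; apply: UwU.
  case/setU1P: zU Zz => [->|Uz] Zz; last by exists z.
  by exists u => //; apply: Zadj (UwU _ Uu) Zz _; rewrite // adj_sym.
move=> x /setU1P[->|/UZ//].
exact: Zadj (UwU _ Uu) wU (UZ _ Uu) uw.
Qed.

(** * Growing a vertex set that has all 3-cycles through the empty set *)

Definition full U := {in below U &, forall X Y,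
  X != ind0 -> Y != ind0 -> X != Y -> cyc3 ind0 X Y \in D U}.

Lemma full_link U w :
  connected U -> w \in U -> link (D U) ind0 (ind1 w) -> full U.
Proof.
move=> cU Uw lw.
(* The toggle at [y] sends [ind0] to [ind1 y] and fixes [ind1 x] for a neighbour [x], so it carries
   a link between [ind0] and [ind1 x] to one between [ind1 y] and [ind1 x]. *)
have lU : {in U, forall v, link (D U) ind0 (ind1 v)}.
  apply: cU => [|x y Ux Uy lx xy]; first by exists w.
  apply: link_trans (lx) _; apply: link_sym.
  have := linkJ (toggle_norm Uy) lx.
  by rewrite toggle0 toggle1_adj // adj_sym.
have valt v X : v \in val X -> val (toggle L v X) = val X :\ v.
  by move=> Xv; rewrite val_toggle Xv.
(* For another element [y] of [X], the toggle at [y] carries the link that adds [v] to [X] without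
   [y] to the link wanted for [X]; this reduces to singletons. *)
have grow n X v : #|val X| <= n -> val X \subset U -> v \in val X ->
    link (D U) (toggle L v X) X.
  elim: n => [|n IHn] in X *.
    by rewrite leqn0 cards_eq0 => /eqP X0 _ Xv; rewrite X0 in_set0 in Xv.
  move=> Xn XU Xv; have [Xv1|] := eqVneq (val X :\ v) set0.
    have -> : toggle L v X = ind0 by apply: val_inj; rewrite valt.
    suff -> : X = ind1 v by apply: lU; apply: (subsetP XU).
    by apply: val_inj; rewrite -(setD1K Xv) Xv1 setU0.
  case/set0Pn=> y; rewrite !inE => /andP[yv Xy].
  have Uy := subsetP XU y Xy.
  have := linkJ (toggle_norm Uy) (IHn (toggle L y X) _ _ _).
  have -> : toggle L y (toggle L v (toggle L y X)) = toggle L v X.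
    rewrite -[RHS](toggleK y); congr (toggle L y _); apply: val_inj.
    rewrite !valt ?inE ?yv ?[v == y]eq_sym ?yv //.
    by rewrite !setDDl setUC.
  rewrite toggleK; apply; rewrite valt //.
  - by rewrite [X in X <= _](cardsD1 y) Xy in Xn.
  - exact: subset_trans (subsetDl _ _) XU.
  - by rewrite !inE eq_sym yv.
have {lU grow} l0 X : val X \subset U -> link (D U) ind0 X.
  have [n] := ubnP #|val X|; elim: n X => // n IHn X Xn XU.
  have [X0|] := eqVneq (val X) set0.
    by left; apply: val_inj.
  case/set0Pn=> v Xv; apply: link_trans (grow _ X v (leqnn _) XU Xv).
  apply: IHn; rewrite valt //; last exact: subset_trans (subsetDl _ _) XU.
  by rewrite [X in X < _](cardsD1 v) Xv in Xn.
move=> X Y; rewrite ![_ \in below U]inE => XU YU X0 Y0 XY.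
(* With a concrete group, [done] would try to decide membership by enumeration. *)
move: (D U) l0 => G l0; have : cyc3 X ind0 Y \in G.
  by apply: cyc3_link; rewrite // 1?eq_sym //; [apply: link_sym|]; apply: l0.
rewrite cyc3_rot 1?eq_sym //; last by rewrite eq_sym.
by rewrite -cyc3V groupV.
Qed.
Lemma ind1_neq0 v : ind1 v != ind0.
Proof. by apply/eqP=> /(congr1 val)/setP/(_ v); rewrite !inE eqxx. Qed.

Lemma ind1_eq v w : (ind1 v == ind1 w) = (v == w).
Proof.
apply/eqP/eqP=> [/(congr1 val)/setP/(_ v)|->//].
by rewrite !inE eqxx => /esym/eqP.
Qed.

(** Inside [[set u]] the toggle at [u] is a transposition. Its commutator with the toggle at [w] is
    a product of two transpositions sharing [ind1 u], hence a 3-cycle on [ind0], [ind1 u] and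
    [ind1 w]. *)
Lemma full_edge u w : adj u w -> full (w |: [set u]).
Proof.
move=> uw; have wu : w != u by apply: contraTneq uw => ->; rewrite adj_irr.
have uU : u \in [set u] by rewrite inE.
have wB : w \in boundary [set u].
  by apply/boundaryP; rewrite !inE wu; split=> //; exists u.
have sid X : w \in val X -> tperm ind0 (ind1 u) X = X.
  move=> wX; rewrite tpermD //; apply: contraTneq wX => <-; rewrite !inE //.
have ts : agree (below [set u]) (toggle L u) (tperm ind0 (ind1 u)).
  apply/agreeP=> X Xu; split; last first.
    by move: Xu; rewrite !inE compatible_subset ?toggle_compatible.
  move: Xu; rewrite inE subset1 => /orP[] /eqP Xu.
    have -> : X = ind1 u by apply: val_inj.
    by rewrite tpermR -toggle0 toggleK.
  have -> : X = ind0 by apply: val_inj.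
  by rewrite tpermL toggle0.
have tL : toggle L u \in M [set u].
  rewrite inE toggle_in_group andbT; apply/localP; split=> [|X].
    exact: toggle_compatible.
  case/pred0Pn=> y /= /andP[Xy /boundaryP[yu [x /set1P-> uy]]].
  have uX : u \notin val X.
    by apply: contraTN uy => uX; have /independentP-> := valP X.
  apply: val_inj; rewrite val_toggle (negPf uX) ifT //.
  by apply/exists_inP; exists y.
have [] := commutator_trace tL wB ts sid.
rewrite commgEl tpermV tpermJ toggle0 toggle1_adj 1?adj_sym // => Duw _.
apply: (full_link (w := w)); rewrite ?setU11 //.
  exact: (connectedU1 (@connected1 u) wB).
move: (D (w |: [set u])) Duw => G Duw.
right; exists (ind1 u); rewrite ind1_neq0 ind1_eq eq_sym wu; split=> //.
rewrite -(@cyc3_rot _ (ind1 u)) ?ind1_eq;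
  [ | by rewrite eq_sym | by rewrite eq_sym ind1_neq0].
by rewrite /cyc3 [tperm (ind1 u) _]tpermC [tperm (ind1 u) (ind1 w)]tpermC.
Qed.

(** With [x] a second vertex of [U], the commutator of the 3-cycle on [ind0], [ind1 x], [ind1 u]
    with the toggle at [w] is a 3-cycle if the toggle fixes [ind1 x], and otherwise a 5-cycle, which
    a further commutator turns into a 3-cycle. *)
Lemma full_step U w :
  full U -> connected U -> 1 < #|U| -> w \in boundary U -> full (w |: U).
Proof.
move=> fU cU U1 wB; have [wU [u Uu uw]] := boundaryP _ _ wB.
have [x Ux xu] : exists2 x, x \in U & x != u.
  move: U1; rewrite (cardsD1 u) Uu => /card_gt0P[x].
  by rewrite !inE => /andP[xu Ux]; exists x.
have neqw v : v \in U -> v != w by apply: contraTneq => ->.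
pose a := ind0; pose b := ind1 x; pose c := ind1 u; pose t := toggle L w.
have belowE X : (X \in below U) = (val X \subset U) by rewrite inE.
have [ab ac bc] : [/\ a != b, a != c & b != c].
  by rewrite eq_sym ind1_neq0 eq_sym ind1_neq0 ind1_eq.
have Ds : cyc3 a b c \in D U.
  by apply: fU; rewrite ?ind1_neq0 // belowE sub1set.
have [g gM gs] := traceP _ _ _ Ds.
have sid X : w \in val X -> cyc3 a b c X = X.
  by move=> wX; rewrite cyc3D //; apply: contraTneq wX => <-;
     rewrite inE // eq_sym neqw.
have [Dst sN] := commutator_trace gM wB gs sid.
have ta : t a = ind1 w by apply: toggle0.
have tc : t c = c by apply: toggle1_adj; rewrite adj_sym.
have [wa wb wc] : [/\ ind1 w != a, ind1 w != b & ind1 w != c].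
  by rewrite ind1_neq0 !ind1_eq ![w == _]eq_sym !neqw.
apply: (full_link (w := w)); rewrite ?setU11 //; first exact: connectedU1.
have Esw : cyc3 a b c ^ t = cyc3 (ind1 w) (t b) c by rewrite cyc3J ta tc.
move: (D (w |: U)) Dst sN => G Dst sN.
right; have [tb | tb] := eqVneq (t b) b.
  move: Dst; rewrite commgEl Esw tb cyc3_quotient // 1?eq_sym // => Dst.
  by exists b; split; rewrite // eq_sym.
exists c; split; rewrite 1?eq_sym //.
rewrite -groupV cyc3V -(@cyc3_commutator _ a b c (ind1 w) (t b)).
  move: Dst; rewrite commgEl Esw => Dst.
  by rewrite commgEr groupM ?memJ_norm ?groupV.
have inj X Y : (t X == t Y) = (X == Y) by apply/inj_eq/perm_inj.
rewrite /= !inE !negb_or ab ac bc.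
have -> : a != ind1 w by rewrite eq_sym.
have -> : b != ind1 w by rewrite eq_sym.
have -> : c != ind1 w by rewrite eq_sym.
have -> : b != t b by rewrite eq_sym.
have -> : c != t b by rewrite -tc inj eq_sym.
have -> : ind1 w != t b by rewrite -ta inj.
have -> : a != t b by rewrite -inj ta toggleK.
by [].
Qed.

Lemma full_alternating : full setT -> toggle_alternating L.
Proof.
move=> fT; apply: (@Alt_sub_cyc3 _ T ind0) => X Y X0 Y0 XY.
have D_sub : D setT \subset T.
  have -> : below setT = setT by apply/setP=> Z; rewrite !inE subsetT.
  exact: subset_trans (trace_setT _) (subsetIr _ _).
by apply: (subsetP D_sub); apply: fT; rewrite // inE subsetT.
Qed.

(** The hypothesis expresses connectedness of the graph: a connected set that is neither empty nor
    everything can be enlarged. *)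
Lemma connected_toggle_alternating :
  (forall U, connected U -> U != set0 -> U != setT -> boundary U != set0) ->
  toggle_alternating L.
Proof.
move=> bU; have [V1|V1] := leqP #|V| 1.
  rewrite /toggle_alternating trivial_Alt_2 ?sub1G // card_sig.
  apply: leq_trans (max_card _) _; rewrite -cardsT -powersetT card_powerset cardsT.
  by rewrite (@leq_exp2l 2 _ 1).
have /card_gt0P[u _] : 0 < #|V| := ltnW V1.
have [w wB] : exists w, w \in boundary [set u].
  apply/set0Pn/bU; [exact: connected1 | by apply/set0Pn; exists u; rewrite inE |].
  by apply: contraTneq V1 => uT; rewrite -cardsT -uT cards1.
have [wu [_ /set1P-> uw]] := boundaryP _ _ wB.
have := full_edge uw; have := connectedU1 (@connected1 u) wB.
have : 1 < #|w |: [set u]| by rewrite cardsU1 wu cards1.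
move: (w |: [set u]) => U.
have [n] := ubnP #|~: U|; elim: n U => // n IHn U Un U1 cU fU.
have [UT | UT] := eqVneq U setT; first by apply: full_alternating; rewrite -UT.
have /set0Pn[v vB] : boundary U != set0.
  by apply: bU => //; rewrite -card_gt0 ltnW.
have [vU _] := boundaryP _ _ vB.
apply: (IHn (v |: U)).
- by move: Un; rewrite (cardsD1 v) inE vU setCU setIC -setDE.
- by rewrite cardsU1 vU ltnW.
- exact: connectedU1.
- exact: full_step.
Qed.

End IndependentSets.

(** * Posets *)

Section Decomposition.

Variables (d : Order.disp_t) (P : finPOrderType d).
Implicit Types (x y z : P) (U : {set P}).

Definition subposet U := {x : P | x \in U}.

HB.instance Definition _ U := SubFinite.on (subposet U).
HB.instance Definition _ U := [SubChoice_isSubPOrder of subposet U by <: with d].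

Lemma decomposable_of_cut U x y :
    x \in U -> y \notin U ->
    (forall u v, u \in U -> v \notin U -> (u < v)%O) ->
  ordinally_decomposable P.
Proof.
move=> Ux Uy UltC.
have UcP z : z \notin U -> z \in ~: U by rewrite inE.
(* [y] serves only as the default for [insubd]; the second branch concerns [z] outside [U], where
   the default is not taken. *)
pose f z : osum (subposet U) (subposet (~: U)) :=
  if insub z is Some a then inl a else inr (insubd (Sub y (UcP y Uy)) z).
pose g (s : osum (subposet U) (subposet (~: U))) : P :=
  match s with inl z => val z | inr z => val z end.
have fK : cancel f g.
  by move=> z; rewrite /f; case: insubP => [a _ //|Uz] /=; rewrite val_insubd UcP.
have g_inj : injective g.
  move=> [] a [] b /= ab; try by congr (_ _); apply: val_inj.
    by case/setCP: (valP b); rewrite /= -ab; apply: (valP a).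
  by case/setCP: (valP a); rewrite /= ab; apply: (valP b).
have gK : cancel g f by move=> s; apply: g_inj; rewrite fK.
exists d, d, (subposet U), (subposet (~: U)); split.
- by apply/card_gt0P; exists (Sub x Ux).
- by apply/card_gt0P; exists (Sub y (UcP y Uy)).
exists f; first by exists g.
move=> u v; rewrite -{2}[u]fK -{2}[v]fK.
move: (f u) (f v) => [a|a] [b|b] //=.
  rewrite [RHS]Order.POrderTheory.ltW // UltC ?(valP a) //.
  by have := valP b; rewrite inE.
apply/esym/negbTE/negP => ba.
have := UltC _ _ (valP b); have := valP a; rewrite inE => Ua /(_ _ Ua).
by move/Order.POrderTheory.lt_geF; rewrite ba.
Qed.

Definition incomparable x y := ~~ (x >=< y)%O.

Lemma incomparable_sym : symmetric incomparable.
Proof. by move=> x y; rewrite /incomparable Order.POrderTheory.comparable_sym. Qed.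

Lemma incomparable_irr : irreflexive incomparable.
Proof. by move=> x; rewrite /incomparable Order.POrderTheory.comparablexx. Qed.

Lemma chains_independent : chains P = independent incomparable.
Proof.
apply/setP=> X; rewrite !inE; apply: eq_forallb => x.
by congr (_ ==> _); apply: eq_forallb => y; rewrite negbK.
Qed.

(** Every [y] outside [U] is comparable to all of [U]. It cannot lie strictly between two
    incomparable elements, so by connectedness it lies on the same side of all of [U]. *)
Lemma boundary_decomposable U :
    connected incomparable U -> U != set0 -> U != setT ->
    boundary incomparable U = set0 ->
  ordinally_decomposable P.
Proof.
move=> cU /set0Pn[u Uu] UT bU.
have cmp x y : x \in U -> y \notin U -> (x >=< y)%O.
  move=> Ux Uy; apply: contraT => xy.
  suff: y \in boundary incomparable U by rewrite bU inE.
  by apply/boundaryP; split=> //; exists x.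
have lt_or_gt x y : x \in U -> y \notin U -> (x < y)%O \/ (y < x)%O.
  move=> Ux Uy; have xy : x != y by apply: contraNneq Uy => <-.
  have /orP[le|le] := cmp x y Ux Uy; [left | right];
  by rewrite Order.POrderTheory.lt_neqAle le ?xy // eq_sym xy.
have incNlt x z : (x < z)%O -> incomparable x z = false.
  by move=> /Order.POrderTheory.ltW xz; rewrite /incomparable /Order.comparable xz.
have incNgt x z : (z < x)%O -> incomparable x z = false.
  by rewrite incomparable_sym; apply: incNlt.
have lt_all y : y \notin U -> (u < y)%O -> {in U, forall x, (x < y)%O}.
  move=> Uy uy; apply: cU; first by exists u.
  move=> x z Ux Uz xy; have [//|yz] := lt_or_gt z y Uz Uy.
  by rewrite incNlt // (Order.POrderTheory.lt_trans xy).
have gt_all y : y \notin U -> (y < u)%O -> {in U, forall x, (y < x)%O}.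
  move=> Uy uy; apply: cU; first by exists u.
  move=> x z Ux Uz xy; have [zy|//] := lt_or_gt z y Uz Uy.
  by rewrite incNgt // (Order.POrderTheory.lt_trans zy).
have [v vU] : exists v, v \notin U.
  by apply/existsP; apply: contraNT UT; rewrite negb_exists => /forallP vU;
     apply/eqP/setP=> v; rewrite inE; apply/negPn/vU.
(* The elements below [U], tested at [u] alone. If there are none, [U] is a bottom summand;
   otherwise [D] is one, since all of [U], and with it everything above [U], lies above [D]. *)
pose D := [set y in ~: U | (y < u)%O].
have DP y : (y \in D) = (y \notin U) && (y < u)%O by rewrite !inE.
have [D0 | /set0Pn[y Dy]] := eqVneq D set0.
  apply: (decomposable_of_cut Uu vU) => x y Ux Uy; apply: lt_all => //.
  have [//|yu] := lt_or_gt u y Uu Uy.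
  by have := in_set0 y; rewrite -D0 DP Uy yu.
have uD : u \notin D by rewrite DP Uu.
apply: (decomposable_of_cut Dy uD) => x z; rewrite !DP => /andP[Ux xu].
have [Uz _ | Uz /= zu] := boolP (z \in U); first exact: gt_all.
have [uz|zu'] := lt_or_gt u z Uu Uz; last by rewrite zu' in zu.
exact: Order.POrderTheory.lt_trans uz.
Qed.

End Decomposition.

(** * Toggle groups of set families that split as products *)

Section Product.

Local Open Scope group_scope.

Variables (E E1 E2 : finType).
Variables (L : {set {set E}}) (L1 : {set {set E1}}) (L2 : {set {set E2}}).
Variables (f : E -> E1 + E2) (h : E1 + E2 -> E).
Hypotheses (fK : cancel f h) (hK : cancel h f).

Local Notation left X := [set a | h (inl a) \in (X : {set E})].
Local Notation right X := [set b | h (inr b) \in (X : {set E})].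

Hypothesis LE : forall X, (X \in L) = (left X \in L1) && (right X \in L2).

Local Notation S := {X : {set E} | X \in L}.
Local Notation S1 := {X : {set E1} | X \in L1}.
Local Notation S2 := {X : {set E2} | X \in L2}.

Fact left_subproof (X : S) : left (val X) \in L1.
Proof. by have := valP X; rewrite LE => /andP[]. Qed.

Fact right_subproof (X : S) : right (val X) \in L2.
Proof. by have := valP X; rewrite LE => /andP[]. Qed.

Definition split_set (X : S) : S1 * S2 :=
  (Sub (left (val X)) (left_subproof X), Sub (right (val X)) (right_subproof X)).

Definition join_raw (A : {set E1}) (B : {set E2}) : {set E} :=
  [set e | match f e with inl a => a \in A | inr b => b \in B end].

Lemma left_join A B : left (join_raw A B) = A.
Proof. by apply/setP=> a; rewrite !inE hK. Qed.

Lemma right_join A B : right (join_raw A B) = B.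
Proof. by apply/setP=> b; rewrite !inE hK. Qed.

Lemma join_left_right X : join_raw (left X) (right X) = X.
Proof. by apply/setP=> e; rewrite !inE; case fe: (f e); rewrite inE -fe fK. Qed.

Fact join_subproof (AB : S1 * S2) : join_raw (val AB.1) (val AB.2) \in L.
Proof. by rewrite LE left_join right_join; apply/andP; split; apply: valP. Qed.

Definition join_set (AB : S1 * S2) : S :=
  Sub (join_raw (val AB.1) (val AB.2)) (join_subproof AB).

Lemma split_setK : cancel split_set join_set.
Proof. by move=> X; apply: val_inj; apply: join_left_right. Qed.

Lemma join_setK : cancel join_set split_set.
Proof.
by case=> A B; congr (_, _); apply: val_inj; rewrite /= ?left_join ?right_join.
Qed.

Definition prod_fun (p : {perm S1} * {perm S2}) (X : S) : S :=
  join_set (p.1 (split_set X).1, p.2 (split_set X).2).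

Lemma prod_fun_inj p : injective (prod_fun p).
Proof.
move=> X Y /(can_inj join_setK)[/perm_inj XY1 /perm_inj XY2].
by apply: (can_inj split_setK); congr (_, _).
Qed.

Definition prod_perm p : {perm S} := perm (@prod_fun_inj p).

Lemma prod_permM : {morph prod_perm : p q / p * q}.
Proof.
move=> p q; apply/permP=> X; rewrite permM !permE /prod_fun join_setK /=.
by rewrite !permM.
Qed.

Canonical prod_perm_morphism := @Morphism _ _ setT prod_perm (in2W prod_permM).

(** If [S2] were empty, there would be no pairs and the action could not see [p.1]; the points [A]
    and [B] exclude this on both sides. *)
Lemma injm_prod_perm (A : S1) (B : S2) : 'injm prod_perm.
Proof.
apply/injmP=> p q _ _ /permP pq.
have pqE A' B' : p.1 A' = q.1 A' /\ p.2 B' = q.2 B'.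
  have := pq (join_set (A', B')); rewrite !permE /prod_fun join_setK.
  by move/(can_inj join_setK) => [].
rewrite [p]surjective_pairing [q]surjective_pairing; congr (_, _).
  by apply/permP=> A'; case: (pqE A' B).
by apply/permP=> B'; case: (pqE A B').
Qed.

Lemma toggle_inl a : toggle L (h (inl a)) = prod_perm (toggle L1 a, 1).
Proof.
have h_inj := can_inj hK.
apply/permP=> X; rewrite [RHS]permE; apply: (canRL split_setK).
have /andP[_ rX] : (left (val X) \in L1) && (right (val X) \in L2).
  by rewrite -LE (valP X).
have leftU : left (h (inl a) |: val X) = a |: left (val X).
  by apply/setP=> x; rewrite !inE (inj_eq h_inj).
have rightU : right (h (inl a) |: val X) = right (val X).
  by apply/setP=> x; rewrite !inE (inj_eq h_inj).
have leftD : left (val X :\ h (inl a)) = left (val X) :\ a.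
  by apply/setP=> x; rewrite !inE (inj_eq h_inj).
have rightD : right (val X :\ h (inl a)) = right (val X).
  by apply/setP=> x; rewrite !inE (inj_eq h_inj).
have aX : (a \in left (val X)) = (h (inl a) \in val X) by rewrite inE.
congr (_, _); apply: val_inj; rewrite /= ?perm1 !permE /= /toggle_set.
  rewrite aX !LE leftU rightU leftD rightD rX !andbT.
  by case: ifP => _; [|case: ifP => _].
by case: ifP => _; [|case: ifP => _].
Qed.

Lemma toggle_inr b : toggle L (h (inr b)) = prod_perm (1, toggle L2 b).
Proof.
have h_inj := can_inj hK.
apply/permP=> X; rewrite [RHS]permE; apply: (canRL split_setK).
have /andP[lX _] : (left (val X) \in L1) && (right (val X) \in L2).
  by rewrite -LE (valP X).
have leftU : left (h (inr b) |: val X) = left (val X).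
  by apply/setP=> x; rewrite !inE (inj_eq h_inj).
have rightU : right (h (inr b) |: val X) = b |: right (val X).
  by apply/setP=> x; rewrite !inE (inj_eq h_inj).
have leftD : left (val X :\ h (inr b)) = left (val X).
  by apply/setP=> x; rewrite !inE (inj_eq h_inj).
have rightD : right (val X :\ h (inr b)) = right (val X) :\ b.
  by apply/setP=> x; rewrite !inE (inj_eq h_inj).
have bX : (b \in right (val X)) = (h (inr b) \in val X) by rewrite inE.
congr (_, _); apply: val_inj; rewrite /= ?perm1 !permE /= /toggle_set.
  by case: ifP => _; [|case: ifP => _].
rewrite bX !LE leftU rightU leftD rightD lX /=.
by case: ifP => _; [|case: ifP => _].
Qed.

Lemma prod_perm_toggle_group :
  prod_perm @* setX (toggle_group L1) (toggle_group L2) = toggle_group L.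
Proof.
apply/eqP; rewrite eqEsubset; apply/andP; split; last first.
  rewrite gen_subG; apply/subsetP=> _ /imsetP[e _ ->].
  rewrite -(fK e); case: (f e) => [a|b].
    rewrite toggle_inl mem_morphim ?inE //= group1 andbT mem_gen ?imset_f //.
  by rewrite toggle_inr mem_morphim ?inE //= group1 mem_gen ?imset_f.
(* Pulling the toggle group of [L] back along the embedding of a factor gives a subgroup that
   contains the toggles, hence the whole toggle group of that factor. *)
have G1 : toggle_group L1 \subset
    @pairg1 _ {perm S2} @*^-1 (prod_perm @*^-1 toggle_group L).
  rewrite gen_subG; apply/subsetP=> _ /imsetP[a _ ->].
  by rewrite !inE /= /pairg1 -toggle_inl mem_gen ?imset_f.
have G2 : toggle_group L2 \subset
    @pair1g {perm S1} _ @*^-1 (prod_perm @*^-1 toggle_group L).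
  rewrite gen_subG; apply/subsetP=> _ /imsetP[b _ ->].
  by rewrite !inE /= /pair1g -toggle_inr mem_gen ?imset_f.
apply/subsetP=> _ /morphimP[[p q] _ /setXP[/= p1 q2] ->].
have -> : (p, q) = (p, 1) * (1, q) by congr (_, _); rewrite /= ?mulg1 ?mul1g.
rewrite prod_permM groupM //.
  by have := subsetP G1 p p1; rewrite !inE.
by have := subsetP G2 q q2; rewrite !inE.
Qed.

Lemma toggle_group_prod (A : S1) (B : S2) :
  toggle_group L \isog setX (toggle_group L1) (toggle_group L2).
Proof.
rewrite isog_sym -prod_perm_toggle_group.
by apply: sub_isog; [apply: subsetT | apply: injm_prod_perm].
Qed.

End Product.

(** * Chains of ordinal sums, and the two halves of the theorem *)

Lemma chainsP (d : Order.disp_t) (P : finPOrderType d) (X : {set P}) :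
  reflect {in X &, forall x y, (x >=< y)%O} (X \in chains P).
Proof.
rewrite inE; apply: (iffP forall_inP) => chX x => [y Xx Xy | Xx].
  by have /forall_inP := chX x Xx; apply.
by apply/forall_inP=> y Xy; apply: chX.
Qed.

(** Elements of different summands are always comparable, so only pairs within one summand impose a
    condition. *)
Lemma chains_osum (d d1 d2 : Order.disp_t) (P : finPOrderType d)
    (P1 : finPOrderType d1) (P2 : finPOrderType d2) (h : osum P1 P2 -> P)
    (X : {set P}) :
  bijective h -> {mono h : x y / (x <= y)%O} ->
  (X \in chains P) = ([set a | h (inl a) \in X] \in chains P1)
                     && ([set b | h (inr b) \in X] \in chains P2).
Proof.
move=> [f hK fK] h_mono.
have hC s t : (h s >=< h t)%O = (s >=< t)%O by rewrite /Order.comparable !h_mono.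
apply/chainsP/andP=> [chX | [/chainsP ch1 /chainsP ch2] x y].
  by split; apply/chainsP=> x y; rewrite !inE => Xx Xy;
    have := chX _ _ Xx Xy; rewrite hC.
rewrite -[x]fK -[y]fK hC; move: (f x) (f y) => [a|a] [b|b] //= Xa Xb.
  by apply: ch1; rewrite inE.
by apply: ch2; rewrite inE.
Qed.

Theorem corollary3p8 (d : Order.disp_t) (P : finPOrderType d) :
  (forall (d1 d2 : Order.disp_t)
          (P1 : finPOrderType d1) (P2 : finPOrderType d2),
     is_ordinal_sum P P1 P2 ->
     toggle_group (chains P) \isog
       setX (toggle_group (chains P1)) (toggle_group (chains P2)))
  /\
  (~ ordinally_decomposable P -> toggle_alternating (chains P)).
Proof.
split=> [d1 d2 P1 P2 [f [h fK hK] f_mono] | Pindec].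
  have h_mono : {mono h : x y / (x <= y)%O} by move=> x y; rewrite -f_mono !hK.
  (* The empty chains are the base points needed for injectivity of the product action. *)
  have empty_chain d' (Q : finPOrderType d') : set0 \in chains Q.
    by apply/chainsP=> x; rewrite inE.
  apply: (toggle_group_prod fK hK) => [X | |].
  - by apply: chains_osum h_mono; exists f.
  - by exists set0.
  - by exists set0.
rewrite chains_independent; apply: connected_toggle_alternating.
- exact: incomparable_sym.
- exact: incomparable_irr.
move=> U cU U0 UT; apply/negP=> /eqP bU.
exact: Pindec (boundary_decomposable cU U0 UT bU).
Qed.
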